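(* For all integers $n,k$ with $2\le n < k < \infty$, we have $$2\, d_{\mathrm{GH}}(S^n, S^k) \le \max \left\{\arccos\left(\frac{-(k-1)}{k+1}\right),\ \pi - p_{k+1}(\mathbb{R}\mathrm{P}^n),\ 2\,p_{k+1}(\mathbb{R}\mathrm{P}^n) \right\}.$$
   Context: For an integer $n\ge 1$, $S^n=\{x\in\mathbb{R}^{n+1} : \langle x,x\rangle=1\}$ is the unit sphere equipped with the geodesic metric $d_{S^n}(x,x')=\arccos(\langle x,x'\rangle)$. A correspondence between sets $X$ and $Y$ is a relation $R\subseteq X\times Y$ whose coordinate projections to $X$ and to $Y$ are both surjective. For metric spaces $(X,d_X)$, $(Y,d_Y)$, the distortion of $R$ is $\operatorname{dis}(R)=\sup_{(x,y),(x',y')\in R}|d_X(x,x')-d_Y(y,y')|$. The Gromov--Hausdorff distance between compact metric spaces $X,Y$ is given by $2\,d_{\mathrm{GH}}(X,Y)=\inf_R \operatorname{dis}(R)$, the infimum being over all correspondences $R\subseteq X\times Y$. Real projective space $\mathbb{R}\mathrm{P}^n=S^n/\{\pm1\}$ carries the quotient metric $d_{\mathbb{R}\mathrm{P}^n}$ induced by the geodesic metric on $S^n$, i.e. $d_{\mathbb{R}\mathrm{P}^n}([x],[y])=\min\{d_{S^n}(x,y),d_{S^n}(x,-y)\}$. The packing parameter is $$p_m(\mathbb{R}\mathrm{P}^n)=\sup\{\varepsilon>0 : \text{there exist } x_1,\dots,x_m\in\mathbb{R}\mathrm{P}^n \text{ with } d_{\mathbb{R}\mathrm{P}^n}(x_i,x_j)\ge\varepsilon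 \text{ for all } i\ne j\}.$$ *)

(* Defs.v *)
From HB Require Import structures.
From mathcomp Require Import all_boot all_order all_algebra.
From mathcomp Require Import generic_quotient ring lra.
From mathcomp Require Import all_classical all_reals all_analysis.
Set Implicit Arguments.
Unset Strict Implicit.
Unset Printing Implicit Defensive.
Import Order.TTheory GRing.Theory Num.Theory.
Local Open Scope classical_set_scope.
Local Open Scope ring_scope.

Section GromovHausdorff.
Context {R : realType}.

Definition correspondence (X Y : Type) (C : set (X * Y)) : Prop :=
  fst @` C = setT /\ snd @` C = setT.

(* Extended-real valued because metric spaces need not be bounded; for compact
   nonempty X and Y it is a finite nonnegative number. *)
Definition distortion (X Y : metricType R) (C : set (X * Y)) : \bar R :=
  ereal_sup [set (`|mdist p.1 q.1 - mdist p.2 q.2|)%:E | p in C & q in C].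

Definition dGH (X Y : metricType R) : \bar R :=
  ((2^-1)%:E *
   ereal_inf [set distortion C | C in @correspondence X Y])%E.

(* For m <= 1 and X nonempty the condition is void and the supremum is +oo. *)
Definition packing (m : nat) (X : metricType R) : \bar R :=
  ereal_sup [set eps%:E | eps in
    [set eps : R | 0 < eps /\
       exists x : 'I_m -> X,
         forall i j : 'I_m, i != j -> eps <= mdist (x i) (x j)]].

End GromovHausdorff.

Section DotProduct.
Context {R : realType} {d : nat}.
Implicit Types (x y z : 'rV[R]_d) (a : R).

Definition dot x y : R := \sum_i x 0 i * y 0 i.

Lemma dotC x y : dot x y = dot y x.
Proof. by apply: eq_bigr => i _; rewrite mulrC. Qed.

Lemma dotDl x y z : dot (x + y) z = dot x z + dot y z.
Proof. by rewrite -big_split; apply: eq_bigr => i _; rewrite mxE mulrDl. Qed.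

Lemma dotZl a x y : dot (a *: x) y = a * dot x y.
Proof. by rewrite mulr_sumr; apply: eq_bigr => i _; rewrite mxE mulrA. Qed.

Lemma dotDr x y z : dot x (y + z) = dot x y + dot x z.
Proof. by rewrite dotC dotDl !(dotC x). Qed.

Lemma dotZr a x y : dot x (a *: y) = a * dot x y.
Proof. by rewrite dotC dotZl dotC. Qed.

Lemma dotNl x y : dot (- x) y = - dot x y.
Proof. by rewrite -scaleN1r dotZl mulN1r. Qed.

Lemma dotNr x y : dot x (- y) = - dot x y.
Proof. by rewrite dotC dotNl dotC. Qed.

Lemma dot_ge0 x : 0 <= dot x x.
Proof. by apply: sumr_ge0 => i _; rewrite -expr2 sqr_ge0. Qed.

Lemma dot_eq0 x : dot x x = 0 -> x = 0.
Proof.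
move=> /eqP; rewrite psumr_eq0; last by move=> i _; rewrite -expr2 sqr_ge0.
move=> /allP h; apply/rowP => i; rewrite mxE; apply/eqP.
by have := h i (mem_index_enum i); rewrite /= mulf_eq0 orbb.
Qed.

Lemma dot_CauchySchwarz x y : dot x y ^+ 2 <= dot x x * dot y y.
Proof.
have [/dot_eq0 ->|y0] := eqVneq (dot y y) 0.
  by rewrite dotC -(scale0r (0 : 'rV[R]_d)) !(dotZl, dotZr) !mul0r expr0n mulr0.
have ypos : 0 < dot y y by rewrite lt_def y0 dot_ge0.
rewrite -subr_ge0 -(pmulr_rge0 _ ypos).
have := dot_ge0 (dot y y *: x + (- dot x y) *: y).
by rewrite !(dotDl, dotDr, dotZl, dotZr) (dotC y x); congr (0 <= _); ring.
Qed.

End DotProduct.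

Definition sphere (R : realType) (n : nat) : Type :=
  {x : 'rV[R]_n.+1 | dot x x == 1}.
HB.instance Definition _ (R : realType) (n : nat) := Choice.on (sphere R n).

Section Sphere.
Context {R : realType} {n : nat}.
Implicit Types x y z : sphere R n.

Definition sphere_dist x y : R := acos (dot (val x) (val y)).

Lemma sphere_dotxx x : dot (val x) (val x) = 1.
Proof. by apply/eqP; exact: (valP x). Qed.

Lemma sphere_opp_subproof x : dot (- val x) (- val x) == 1.
Proof. by rewrite dotNl dotNr opprK sphere_dotxx. Qed.

Definition sphere_opp x : sphere R n :=
  exist (fun u : 'rV[R]_n.+1 => dot u u == 1) (- val x) (sphere_opp_subproof x).

Lemma sphere_oppK : involutive sphere_opp.
Proof. by move=> x; apply: val_inj; rewrite /= opprK. Qed.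

Lemma sphere_dot_itv x y : -1 <= dot (val x) (val y) <= 1.
Proof.
have := dot_CauchySchwarz (val x) (val y); rewrite !sphere_dotxx => h.
by apply/andP; split; nra.
Qed.

Lemma cos_sphere_dist x y : cos (sphere_dist x y) = dot (val x) (val y).
Proof. by rewrite /sphere_dist acosK// in_itv/= sphere_dot_itv. Qed.

Lemma sphere_dist_itv x y : 0 <= sphere_dist x y <= pi.
Proof. by rewrite acos_ge0 ?acos_lepi// sphere_dot_itv. Qed.

Lemma sphere_distxx x : sphere_dist x x = 0.
Proof. by rewrite /sphere_dist sphere_dotxx acos1. Qed.

Lemma sphere_distC x y : sphere_dist x y = sphere_dist y x.
Proof. by rewrite /sphere_dist dotC. Qed.

Lemma sphere_dist_eq0 x y : sphere_dist x y = 0 -> x = y.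
Proof.
move=> /(congr1 cos); rewrite cos_sphere_dist cos0 => xy.
apply: val_inj; apply/eqP; rewrite -subr_eq0; apply/eqP/dot_eq0.
rewrite !(dotDl, dotDr, dotNl, dotNr) !sphere_dotxx (dotC (val y)) xy.
by ring.
Qed.

Lemma sphere_dist_triangle y x z :
  sphere_dist x z <= sphere_dist x y + sphere_dist y z.
Proof.
set a := sphere_dist x y; set b := sphere_dist y z.
have /andP[c0 cpi] := sphere_dist_itv x z.
have aI := sphere_dist_itv x y; have bI := sphere_dist_itv y z.
have [/andP[a0 api] /andP[b0 bpi]] := (aI, bI).
have [/ltW piab|abpi] := ltP pi (a + b); first exact: le_trans cpi piab.
rewrite leNgt -ltr_cos ?in_itv/= ?c0 ?cpi ?addr_ge0// -leNgt.
rewrite cosD !cos_sphere_dist.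
have sa : sin a ^+ 2 = 1 - dot (val x) (val y) ^+ 2.
  by rewrite sin2cos2 cos_sphere_dist.
have sb : sin b ^+ 2 = 1 - dot (val y) (val z) ^+ 2.
  by rewrite sin2cos2 cos_sphere_dist.
have sa0 : 0 <= sin a by exact: sin_ge0_pi.
have sb0 : 0 <= sin b by exact: sin_ge0_pi.
have := dot_CauchySchwarz (val x - dot (val x) (val y) *: val y)
                          (val z - dot (val y) (val z) *: val y).
rewrite !(dotDl, dotDr, dotNl, dotNr, dotZl, dotZr) !sphere_dotxx.
rewrite (dotC (val y) (val x)) (dotC (val z) (val y)).
set p := dot (val x) (val y) in sa *; set q := dot (val y) (val z) in sb *.
set r := dot (val x) (val z) => CS.
have {}CS : (r - p * q) ^+ 2 <= (sin a * sin b) ^+ 2.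
  rewrite exprMn sa sb.
  by move: CS; congr (_ <= _); ring.
have s0 := mulr_ge0 sa0 sb0.
suff : - (sin a * sin b) <= r - p * q by lra.
by move: CS s0; move: (r - _) (sin a * _) => t s; nra.
Qed.

Lemma sphere_dist_opp x y :
  sphere_dist (sphere_opp x) (sphere_opp y) = sphere_dist x y.
Proof. by rewrite /sphere_dist/= dotNl dotNr opprK. Qed.

Lemma sphere_dist_oppC x y :
  sphere_dist (sphere_opp x) y = sphere_dist x (sphere_opp y).
Proof. by rewrite -sphere_dist_opp sphere_oppK. Qed.

HB.instance Definition _ := @isMetric.Build R (sphere R n)
  sphere_dist sphere_distxx sphere_dist_eq0 sphere_distC sphere_dist_triangle.

Definition antipodal x y : bool := (x == y) || (x == sphere_opp y).

Lemma antipodal_refl : reflexive antipodal.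
Proof. by move=> x; rewrite /antipodal eqxx. Qed.

Lemma antipodal_sym : symmetric antipodal.
Proof.
move=> x y; rewrite /antipodal (eq_sym x y); congr orb.
by rewrite -(inv_eq sphere_oppK) eq_sym.
Qed.

Lemma antipodal_trans : transitive antipodal.
Proof.
move=> y x z; rewrite /antipodal => /orP[]/eqP-> // /orP[]/eqP->.
  by rewrite eqxx orbT.
by rewrite sphere_oppK eqxx.
Qed.

Canonical antipodal_equiv :=
  EquivRel antipodal antipodal_refl antipodal_sym antipodal_trans.

End Sphere.

Definition RP (R : realType) (n : nat) : Type :=
  {eq_quot (@antipodal_equiv R n)}%qT.
HB.instance Definition _ (R : realType) (n : nat) := Choice.on (RP R n).
HB.instance Definition _ (R : realType) (n : nat) := EqQuotient.on (RP R n).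

Section RealProjectiveSpace.
Context {R : realType} {n : nat}.
Implicit Types (x y : sphere R n) (u v w : RP R n).

Definition antipodal_dist x y : R :=
  Num.min (sphere_dist x y) (sphere_dist x (sphere_opp y)).

(* Independent of the chosen representatives: see RP_dist_pi. *)
Definition RP_dist u v : R := antipodal_dist (repr u) (repr v).

Lemma antipodal_distNl x y :
  antipodal_dist (sphere_opp x) y = antipodal_dist x y.
Proof. by rewrite /antipodal_dist sphere_dist_oppC sphere_dist_opp minC. Qed.

Lemma antipodal_distC x y : antipodal_dist x y = antipodal_dist y x.
Proof.
by rewrite /antipodal_dist sphere_distC (sphere_distC x) sphere_dist_oppC.
Qed.

Lemma antipodal_dist_triangle y x z :
  antipodal_dist x z <= antipodal_dist x y + antipodal_dist y z.
Proof.
rewrite /antipodal_dist !minEle.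
have h1 := sphere_dist_triangle y x z.
have h2 := sphere_dist_triangle (sphere_opp y) x z.
have h3 := sphere_dist_triangle y x (sphere_opp z).
have h4 := sphere_dist_triangle (sphere_opp y) x (sphere_opp z).
rewrite sphere_dist_oppC in h2; rewrite sphere_dist_opp in h4.
by case: ifP => ?; case: ifP => ?; case: ifP => ?; lra.
Qed.

Lemma antipodal_distl x x' y :
  antipodal x x' -> antipodal_dist x y = antipodal_dist x' y.
Proof. by case/orP => /eqP->//; rewrite antipodal_distNl. Qed.

Lemma RP_dist_pi x y :
  RP_dist (\pi_(RP R n) x)%qT (\pi_(RP R n) y)%qT =
  Num.min (sphere_dist x y) (sphere_dist x (sphere_opp y)).
Proof.
have reprE z : antipodal (repr (\pi_(RP R n) z)%qT) z.
  by rewrite -(eqquotE (RP R n)) reprK.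
rewrite /RP_dist (antipodal_distl _ (reprE x)) antipodal_distC.
by rewrite (antipodal_distl _ (reprE y)) antipodal_distC.
Qed.

Lemma RP_distxx u : RP_dist u u = 0.
Proof.
rewrite /RP_dist /antipodal_dist sphere_distxx; apply/min_idPl.
by have /andP[] := sphere_dist_itv (repr u) (sphere_opp (repr u)).
Qed.

Lemma RP_dist_eq0 u v : RP_dist u v = 0 -> u = v.
Proof.
move=> uv; rewrite -[u]reprK -[v]reprK; apply/eqP; rewrite eqquotE.
move: uv; rewrite /RP_dist /antipodal_dist minEle /= /antipodal.
by case: ifP => _ /sphere_dist_eq0 /eqP ->; rewrite ?orbT.
Qed.

Lemma RP_distC u v : RP_dist u v = RP_dist v u.
Proof. exact: antipodal_distC. Qed.

Lemma RP_dist_triangle v u w : RP_dist u w <= RP_dist u v + RP_dist v w.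
Proof. exact: antipodal_dist_triangle. Qed.

HB.instance Definition _ := @isMetric.Build R (RP R n)
  RP_dist RP_distxx RP_dist_eq0 RP_distC RP_dist_triangle.

End RealProjectiveSpace.

(* Main.v *)
(* Choose k+1 lines [x_i] in R^(n+1) that nearly realise the packing radius p
   and whose p-neighbourhoods nearly cover RP^n.  Match each [x_i] with the
   Voronoi cell of the vertex [e_i] of the cross-polytope in S^k, and [e_i] with
   the Voronoi cell of [x_i] in S^n, and extend antipodally.  Over one index, the
   distortion is controlled by the diameters of the cells, acos(-(k-1)/(k+1)) and
   2p.  Over two different indices, the S^n-distances between centers lie in
   [p, pi - p], those from a center to a foreign cell lie in [p/2, pi - p/2], and
   the corresponding S^k-distances from [e_i] to a foreign cell lie in
   [pi/4, 3pi/4], so the distortion is at most pi - p since p <= pi/2. *)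
Require Import Defs.
From HB Require Import structures.
From mathcomp Require Import all_boot all_order all_algebra.
From mathcomp Require Import generic_quotient ring lra.
From mathcomp Require Import all_classical all_reals all_analysis.
Set Implicit Arguments.
Unset Strict Implicit.
Unset Printing Implicit Defensive.
Import Order.TTheory GRing.Theory Num.Theory.
Local Open Scope ring_scope.

(** * Packing radius and nearly optimal coverings *)

Section Packing.
Context {R : realType} (X : metricType R) (m : nat) (r : R).
Hypothesis packing_r : packing m X = r%:E.

Lemma packing_ge (eps : R) (x : 'I_m -> X) : 0 < eps ->
  (forall i j, i != j -> eps <= mdist (x i) (x j)) -> eps <= r.
Proof.
move=> eps0 sep; rewrite -lee_fin -packing_r.
by apply: ereal_sup_ubound; exists eps => //; split => //; exists x.
Qed.

Lemma packing_approx (t : R) : t < r -> exists (eps : R) (x : 'I_m -> X),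
  [/\ 0 < eps, t < eps & forall i j, i != j -> eps <= mdist (x i) (x j)].
Proof.
rewrite -lte_fin -packing_r => /ereal_sup_gt[_ [eps [eps0 [x sep]] <-]].
by rewrite lte_fin => teps; exists eps, x.
Qed.

(** A finite supremum is approached from below by admissible radii, all of them positive. *)
Lemma packing_gt0 : 0 < r.
Proof.
have /packing_approx[eps [x [eps0 _ sep]]] : r - 1 < r by lra.
exact: lt_le_trans (packing_ge eps0 sep).
Qed.

(* Replacing one point of a pair at distance [< r + delta] by a point at
   distance [>= r + delta] from all the others lowers the number of such
   pairs; since [r] is the supremum, some such pair always exists, hence a
   separated family with the fewest such pairs is also dense. *)
Lemma packing_cover (delta : R) : 0 < delta -> exists x : 'I_m -> X,
  (forall i j, i != j -> r - delta <= mdist (x i) (x j)) /\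
  (forall z, exists i, mdist z (x i) < r + delta).
Proof.
move=> delta0; have r0 := packing_gt0.
pose close (x : 'I_m -> X) :=
  [set p : 'I_m * 'I_m | (p.1 != p.2) && (mdist (x p.1) (x p.2) < r + delta)].
suff main N : forall x : 'I_m -> X, (#|close x| <= N)%N ->
    (forall i j, i != j -> r - delta <= mdist (x i) (x j)) ->
    exists x : 'I_m -> X,
      (forall i j, i != j -> r - delta <= mdist (x i) (x j)) /\
      (forall z, exists i, mdist z (x i) < r + delta).
  have /packing_approx[eps [x [_ reps sep]]] : r - delta < r by lra.
  apply: (main #|close x| x) => // i j /sep; apply: le_trans; exact: ltW.
have close_neq0 x : close x != finset.set0.
  apply/eqP => /finset.setP x0.
  suff : r + delta <= r by lra.
  apply: (@packing_ge _ x); first lra.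
  by move=> i j ij; have := x0 (i, j); rewrite !inE ij/= leNgt => ->.
elim: N => [x|N IH x xN sep].
  by rewrite leqn0 cards_eq0 (negbTE (close_neq0 x)).
have [cov|] := pselect (forall z, exists i, mdist z (x i) < r + delta).
  by exists x.
move=> /existsNP[z /forallNP zfar].
have {}zfar i : r + delta <= mdist z (x i) by rewrite leNgt; apply/negP/zfar.
have /finset.set0Pn[[a b]] := close_neq0 x; rewrite inE/= => /andP[ab dab].
pose x' i := if i == a then z else x i.
apply: (IH x').
  rewrite -ltnS (leq_trans _ xN)//; apply/proper_card/properP; split.
    apply/fintype.subsetP => -[i j]; rewrite !inE/= /x' => /andP[ij].
    rewrite ij/=; case: (eqVneq i a) ij => [->|_] ij.
      by rewrite eq_sym (negbTE ij) ltNge zfar.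
    by case: eqP => // _; rewrite metric_sym ltNge zfar.
  exists (a, b); rewrite !inE/= ?ab//.
  by rewrite /x' eqxx eq_sym (negbTE ab)/= -leNgt zfar.
have far i : r - delta <= mdist z (x i) by have := zfar i; lra.
move=> i j ij; rewrite /x'; case: (eqVneq i a) ij => [->|_] ij.
  by rewrite eq_sym (negbTE ij).
by case: eqP => _; [rewrite metric_sym far | exact: sep].
Qed.

End Packing.

(** * Antipodal symmetry and correspondences given up to sign *)

Section Flip.
Context {R : realType} {n : nat}.
Implicit Types (x y z : sphere R n).

Lemma sphere_distNr x y : sphere_dist x (sphere_opp y) = pi - sphere_dist x y.
Proof. by rewrite /sphere_dist dotNr acosN// sphere_dot_itv. Qed.

Lemma sphere_distNl x y : sphere_dist (sphere_opp x) y = pi - sphere_dist x y.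
Proof. by rewrite sphere_dist_oppC sphere_distNr. Qed.

Definition flip (b : bool) x := if b then sphere_opp x else x.

Lemma flipK b : involutive (flip b).
Proof. by case: b => x //; exact: sphere_oppK. Qed.

Lemma antipodal_distE x y :
  antipodal_dist x y = Num.min (sphere_dist x y) (pi - sphere_dist x y).
Proof. by rewrite /antipodal_dist sphere_distNr. Qed.

Lemma antipodal_dist_flip x y :
  exists b, antipodal_dist x y = sphere_dist (flip b x) y.
Proof.
rewrite antipodal_distE minEle; case: ifP => _; first by exists false.
by exists true; rewrite /flip sphere_distNl.
Qed.

Lemma antipodal_dist_flipl b x y :
  antipodal_dist (flip b x) y = antipodal_dist x y.
Proof. by case: b => //; exact: antipodal_distNl. Qed.

End Flip.

(** Each antipode turns a distance [s] into [pi - s] on both spheres at once, so the gap at most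
    changes sign. *)
Lemma gap_flip {R : realType} {n k : nat} (b c : bool) (x x' : sphere R n)
    (y y' : sphere R k) :
  `|sphere_dist (flip b x) (flip c x') - sphere_dist (flip b y) (flip c y')| =
  `|sphere_dist x x' - sphere_dist y y'|.
Proof.
have key (s t : R) : `|(pi - s) - (pi - t)| = `|s - t|.
  by rewrite distrC; congr (`| _ |); ring.
by case: b c => -[]; rewrite /= ?sphere_dist_opp// ?sphere_distNl ?sphere_distNr.
Qed.

(* A relation that is total up to signs generates an antipodally symmetric
   correspondence of the same distortion. *)
Lemma dGH_sphere_le {R : realType} {n k : nat}
    (P : sphere R n -> sphere R k -> Prop) (D : R) :
  (forall x, exists b y, P (flip b x) y) ->
  (forall y, exists b x, P x (flip b y)) ->
  (forall x x' y y', P x y -> P x' y' ->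
     `|sphere_dist x x' - sphere_dist y y'| <= D) ->
  (2%:E * dGH (sphere R n) (sphere R k) <= D%:E)%E.
Proof.
move=> Pl Pr PD; rewrite /dGH muleA -EFinM mulfV ?mul1e; last first.
  by rewrite pnatr_eq0.
pose C : set (sphere R n * sphere R k) :=
  [set p | exists b, P (flip b p.1) (flip b p.2)]%classic.
apply: (@le_trans _ _ (distortion C)).
  apply: ereal_inf_lbound; exists C => //; split; apply/seteqP; split => //.
    move=> x _; have [b [y Pxy]] := Pl x.
    by exists (x, flip b y) => //; exists b; rewrite /= flipK.
  move=> y _; have [b [x Pxy]] := Pr y.
  by exists (flip b x, y) => //; exists b; rewrite /= flipK.
apply: ge_ereal_sup => _ [[x y] [b Pxy] [[x' y'] [c Pxy'] <-]].
by rewrite lee_fin -(gap_flip b c); exact: PD.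
Qed.

(** * Cells of the cross-polytope in the target sphere *)

Section Cell.
Context {R : realType} {k : nat}.
Implicit Types (y : sphere R k) (i j : 'I_k.+1).

Lemma dot_delta i (u : 'rV[R]_k.+1) : dot (delta_mx 0 i) u = u 0 i.
Proof.
rewrite /dot (bigD1 i)//= mxE !eqxx mul1r big1 ?addr0// => j ji.
by rewrite mxE (negbTE ji) andbF mul0r.
Qed.

Lemma basis_subproof i : dot (delta_mx 0 i : 'rV[R]_k.+1) (delta_mx 0 i) == 1.
Proof. by rewrite dot_delta mxE !eqxx. Qed.

Definition basis i : sphere R k :=
  exist (fun u : 'rV[R]_k.+1 => dot u u == 1) (delta_mx 0 i) (basis_subproof i).

Lemma cos_basis i y : cos (sphere_dist (basis i) y) = val y 0 i.
Proof. by rewrite cos_sphere_dist dot_delta. Qed.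

Lemma sphere_dist_basis i j : i != j ->
  sphere_dist (basis i) (basis j) = pi / 2.
Proof.
by move=> ij; rewrite /sphere_dist dot_delta mxE (negbTE ij) andbF acos0.
Qed.

Lemma sphere_sumr y : \sum_j val y 0 j ^+ 2 = 1.
Proof.
rewrite -[RHS](sphere_dotxx y); apply: eq_bigr => j _; exact: expr2.
Qed.

(* The Voronoi cell of [basis i] among the vertices of the cross-polytope. *)
Definition cell i y : Prop := forall j, `|val y 0 j| <= val y 0 i.

Lemma cell_total y : exists b i, cell i (flip b y).
Proof.
case: (@arg_maxP _ R _ ord0 xpredT (fun i => `|val y 0 i|)) => // i _ yi_max.
have {}yi_max j : `|val y 0 j| <= `|val y 0 i| by exact: yi_max.
exists (val y 0 i < 0), i => j; case: ltP => yi /=.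
  by rewrite !mxE normrN -(ltr0_norm yi) yi_max.
by rewrite -[leRHS]ger0_norm// yi_max.
Qed.

Lemma cell_sqr i j y : cell i y -> val y 0 j ^+ 2 <= val y 0 i ^+ 2.
Proof.
move=> yi; rewrite -real_normK ?num_real// lerXn2r ?nnegrE//.
exact: le_trans (yi j).
Qed.

Lemma cell_basis_pihalf i y : cell i y -> sphere_dist (basis i) y <= pi / 2.
Proof.
move=> yi; have /andP[d0 dpi] := sphere_dist_itv (basis i) y.
have := pi_ge0 R => pi0.
rewrite leNgt -ltr_cos ?in_itv/= ?d0 ?dpi//; last by lra.
by rewrite cos_pihalf cos_basis -leNgt; apply: le_trans (yi i).
Qed.

(** The largest of [k + 1] squares with sum 1 is at least [1 / (k + 1)]; the double-angle formula
    turns this into a lower bound on the cosine of twice the distance. *)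
Lemma cell_basis i y : cell i y ->
  sphere_dist (basis i) y *+ 2 <= acos (- (k%:R - 1) / (k%:R + 1)).
Proof.
move=> yi; have /andP[d0 _] := sphere_dist_itv (basis i) y.
have dpi := cell_basis_pihalf yi.
have k0 : 0 <= k%:R :> R by [].
have -> : - (k%:R - 1) / (k%:R + 1) = 2 / (k%:R + 1) - 1 :> R.
  by field; apply: lt0r_neq0; lra.
have c01 : 0 < 2 / (k%:R + 1) :> R by rewrite divr_gt0//; lra.
have sum1 : 1 <= (k%:R + 1) * val y 0 i ^+ 2.
  rewrite -[leLHS](sphere_sumr y) natr1 mulrC mulr_natr.
  rewrite -[X in _ *+ X]card_ord -sumr_const.
  by apply: ler_sum => j _; exact: cell_sqr.
have cy : 2 / (k%:R + 1) <= val y 0 i ^+ 2 *+ 2.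
  by rewrite ler_pdivrMr; lra.
have y1 : val y 0 i ^+ 2 <= 1.
  by rewrite -cos_basis cos2sin2 gerBl sqr_ge0.
have cI : -1 <= (2 / (k%:R + 1) - 1 : R) <= 1.
  by apply/andP; split; lra.
(* Cosines may be compared because the doubled distance stays within [[0, pi]], by [dpi]. *)
rewrite leNgt -ltr_cos ?in_itv/= ?acos_ge0 ?acos_lepi// -?leNgt; last first.
  by lra.
by rewrite acosK ?in_itv//= cos_mulr2n cos_basis lerB.
Qed.

Lemma cell_diam i y y' : cell i y -> cell i y' ->
  sphere_dist y y' <= acos (- (k%:R - 1) / (k%:R + 1)).
Proof.
move=> /cell_basis yi /cell_basis yi'.
apply: le_trans (sphere_dist_triangle (basis i) _ _) _.
by rewrite sphere_distC; lra.
Qed.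

Lemma piquarter_le (t : R) : 0 <= t -> cos t ^+ 2 *+ 2 <= 1 -> pi / 4 <= t.
Proof.
move=> t0 ct; rewrite leNgt; apply/negP => tpi.
have : 0 < cos (t *+ 2) by apply: cos_gt0_pihalf; lra.
by rewrite cos_mulr2n; lra.
Qed.

Lemma cell_basis_far i j y : cell i y -> i != j ->
  pi / 4 <= sphere_dist (basis j) y <= pi - pi / 4.
Proof.
move=> yi ij; have /andP[d0 dpi] := sphere_dist_itv (basis j) y.
(* The squares at [i] and [j] sum to at most 1, and the one at [j] is the smaller. *)
have yj : val y 0 j ^+ 2 *+ 2 <= 1.
  rewrite -[leRHS](sphere_sumr y) (bigD1 i)//= (bigD1 j)//= 1?eq_sym// addrA mulr2n.
  rewrite -[leLHS]addr0; apply: lerD; first by rewrite lerD2r (cell_sqr _ yi).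
  by apply: sumr_ge0 => l _; exact: sqr_ge0.
(* The upper bound is the lower bound for the antipode of [y]. *)
rewrite piquarter_le ?cos_basis//= lerBrDl -lerBrDr piquarter_le//; first lra.
by rewrite -sphere_distNr cos_basis mxE sqrrN.
Qed.

End Cell.

Lemma dist_le {R : realType} (a b c : R) :
  a - b <= c -> b - a <= c -> `|a - b| <= c.
Proof. by move=> h1 h2; rewrite ler_norml h1 andbT lerNl opprB. Qed.

(** * The matching of centers with cells and its distortion *)

Section Correspondence.
Context {R : realType} {n k : nat}.
Variables (X : 'I_k.+1 -> sphere R n) (q rho D : R).
Hypothesis X_sep : forall i j, i != j -> q <= antipodal_dist (X i) (X j).
Hypothesis X_cover : forall z, exists i, antipodal_dist z (X i) < rho.

(** Comparing with [antipodal_dist] makes [X i] a nearest point among all [X j] and their antipodes;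
    the first clause records the covering radius. *)
Definition voronoi i (z : sphere R n) : Prop :=
  sphere_dist z (X i) < rho /\
  forall j, sphere_dist z (X i) <= antipodal_dist z (X j).

Lemma voronoi_total z : exists b i, voronoi i (flip b z).
Proof.
case: (@arg_minP _ R _ ord0 xpredT (fun i => antipodal_dist z (X i))) => //.
move=> i _ imin; have [b zi] := antipodal_dist_flip z (X i).
exists b, i; split; rewrite -zi.
  by have [j] := X_cover z; apply: le_lt_trans; exact: imin.
by move=> j; rewrite antipodal_dist_flipl; exact: imin.
Qed.

Lemma antipodal_dist_le z i :
  antipodal_dist z (X i) <= sphere_dist z (X i) <=
    pi - antipodal_dist z (X i).
Proof.
rewrite antipodal_distE; apply/andP; split; first by rewrite ge_min lexx.
by rewrite lerBrDr addrC -lerBrDr ge_min lexx orbT.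
Qed.

(** In the projective metric [z] is no farther from [X i] than from [X j], so the triangle
    inequality gives at least [q / 2] to the latter. *)
Lemma voronoi_far i j z : voronoi i z -> i != j ->
  q / 2 <= sphere_dist z (X j) <= pi - q / 2.
Proof.
move=> [_ zi] ij; have := zi j; have := antipodal_dist_le z j.
have := antipodal_dist_le z i.
have := X_sep ij; have := antipodal_dist_triangle z (X i) (X j).
by rewrite (antipodal_distC (X i) z); lra.
Qed.

Hypothesis q_le : q <= pi / 2.
Hypothesis diamD : acos (- (k%:R - 1) / (k%:R + 1)) <= D.
Hypothesis sepD : pi - q <= D.
Hypothesis coverD : 2 * rho <= D.

Definition matched (x : sphere R n) (y : sphere R k) : Prop :=
  exists i, (x = X i /\ cell i y) \/ (voronoi i x /\ y = basis i).

Lemma matched_center_voronoi i j y z : cell i y -> voronoi j z ->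
  `|sphere_dist (X i) z - sphere_dist y (basis j)| <= D.
Proof.
have [[qpi qD] rhoD] := (q_le, sepD, coverD).
move=> yi zj; rewrite (sphere_distC (X i)) (sphere_distC y).
(* For equal indices the distances are below [rho] and at most [pi / 2], and [pi / 2 <= pi - q]. *)
have [ij|ij] := eqVneq i j.
  rewrite -ij in zj; have := cell_basis_pihalf yi; case: zj => zi _.
  have := sphere_dist_itv z (X i); have := sphere_dist_itv (basis i) y.
  by rewrite -ij => *; apply: dist_le; lra.
have ji : j != i by rewrite eq_sym.
(* The gap is at most [3 pi / 4 - q / 2], which is below [pi - q] since [q <= pi / 2]. *)
have := voronoi_far zj ji; have := cell_basis_far yi ij.
by move=> *; apply: dist_le; lra.
Qed.

Lemma matched_distortion x x' y y' : matched x y -> matched x' y' ->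
  `|sphere_dist x x' - sphere_dist y y'| <= D.
Proof.
have [[qpi qD] rhoD] := (q_le, sepD, coverD).
move=> [i [[-> yi]|[xi ->]]] [j [[-> yj]|[xj ->]]].
- have [ij|ij] := eqVneq i j.
    rewrite ij sphere_distxx sub0r normrN ger0_norm; last first.
      by have /andP[] := sphere_dist_itv y y'.
    by apply: le_trans diamD; apply: (@cell_diam _ _ i) => //; rewrite ij.
  (* Distinct centers are at distance in [[q, pi - q]], so against any value in [[0, pi]] the gap is
     at most [pi - q]. *)
  have := X_sep ij; have := antipodal_dist_le (X i) j.
  by have := sphere_dist_itv y y' => *; apply: dist_le; lra.
- exact: matched_center_voronoi.
- rewrite (sphere_distC x) (sphere_distC _ y'); exact: matched_center_voronoi.
- have [ij|ij] := eqVneq i j; last first.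
    (* Against [pi / 2] any distance has gap at most [pi / 2 <= pi - q]. *)
    rewrite sphere_dist_basis//; have := sphere_dist_itv x x'.
    by move=> *; apply: dist_le; lra.
  rewrite -ij in xj *; rewrite sphere_distxx.
  have := sphere_dist_triangle (X i) x x'; rewrite (sphere_distC (X i) x').
  have := sphere_dist_itv x x'; case: xi xj => xi _ [xj _] *.
  by apply: dist_le; lra.
Qed.

Lemma matched_dGH : (2%:E * dGH (sphere R n) (sphere R k) <= D%:E)%E.
Proof.
apply: (@dGH_sphere_le _ _ _ matched) => [x|y|]; last exact: matched_distortion.
  by have [b [i xi]] := voronoi_total x; exists b, (basis i), i; right.
by have [b [i yi]] := cell_total y; exists b, (X i), i; left.
Qed.

End Correspondence.

(** * Transfer from projective space to the sphere, and conclusion *)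

Lemma mdist_RP_pihalf {R : realType} {n : nat} (u v : RP R n) :
  mdist u v <= pi / 2.
Proof.
rewrite /mdist/= /RP_dist antipodal_distE.
rewrite ge_min; case: (leP (sphere_dist _ _) (pi / 2)) => //= ?; lra.
Qed.

Lemma RP_cover {R : realType} {n : nat} (rho : R) m (x : 'I_m -> RP R n) :
  (forall u, exists i, mdist u (x i) < rho) ->
  forall z : sphere R n, exists i, antipodal_dist z (repr (x i)) < rho.
Proof.
move=> cov z; have [i H] := cov (\pi_(RP R n) z)%qT; exists i; move: H.
by rewrite -{1}(reprK (x i)) [mdist _ _]RP_dist_pi.
Qed.

Theorem theorem1p3 (R : realType) (n k : nat) (hn : (2 <= n)%N)
    (hnk : (n < k)%N) :
  (2%:E * dGH (sphere R n) (sphere R k) <=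
   maxe (acos (- (k%:R - 1) / (k%:R + 1)))%:E
     (maxe (pi%:E - packing k.+1 (RP R n))
           (2%:E * packing k.+1 (RP R n))))%E.
Proof.
(* An infinite packing value makes the right-hand side [+oo]: [-oo] through the difference, [+oo]
   through the product. *)
case packE : (packing k.+1 (RP R n)) => [r| |]; last first.
- by rewrite !le_max leey orbT.
- by rewrite gt0_muley ?lte_fin// !le_max leey !orbT.
apply/lee_addgt0Pr => e e0.
(* With slack [e / 2] the doubled covering radius exceeds [2 * r] by exactly [e]. *)
have e20 : 0 < e / 2 by rewrite divr_gt0.
have [x [sep cov]] := packing_cover packE e20.
have k0 : (0 < k)%N by apply: leq_trans hnk.
(* Two distinct indices let the diameter bound of projective space limit the separation. *)
have i01 : (ord0 : 'I_k.+1) != ord_max by rewrite eq_sym -val_eqE/= -lt0n.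
have qle : r - e / 2 <= pi / 2.
  exact: le_trans (sep _ _ i01) (mdist_RP_pihalf _ _).
rewrite -!EFinM -EFinB -!EFin_max -EFinD.
set D := _ + e.
apply: (@matched_dGH _ _ _ (repr \o x) (r - e / 2) (r + e / 2)) => //.
- exact: RP_cover.
- by rewrite /D -[leLHS]addr0 lerD ?le_max ?lexx// ltW.
- have : pi - r <= D - e by rewrite /D addrK !le_max lexx orbT.
  lra.
- have : 2 * r <= D - e by rewrite /D addrK !le_max lexx !orbT.
  lra.
Qed.
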